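(* For $n \ge 2$, define a Markov chain $(X_k)_{k \ge 0}$ on $S_n$ by $X_0 = \mathrm{id}$, $X_1 = \pi X_0$ where $\pi$ is a uniformly random $n$-cycle, and $X_k = \tau_k X_{k-1}$ for $k \ge 2$ where $\tau_2, \tau_3, \ldots$ are independent uniformly random transpositions (independent of $\pi$). Let $\mu_k$ be the law of $X_k$, and let $U_k$ be the uniform measure on $A_n$ if $n$ and $k$ have the same parity and the uniform measure on $S_n \setminus A_n$ otherwise (so $U_k$ is uniform on the coset of $A_n$ containing the support of $\mu_k$). Then for any $c>0$, after one $n$-cycle and $cn$ transpositions, $$\frac{e^{-2c}}{e} - o(1) \le \|\mu_{cn+1} - U_{cn+1}\|_{\mathrm{TV}} \le \frac{e^{-2c}}{2\sqrt{1-e^{-4c}}} + o(1)$$ as $n \to \infty$.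
   Context: $\|\mu-\nu\|_{\mathrm{TV}} = \max_{A} |\mu(A)-\nu(A)|$ is the total variation distance. The number $cn$ of transpositions is understood to be an integer (e.g. $\lfloor cn \rfloor$), and $o(1)$ denotes a quantity tending to $0$ as $n \to \infty$ with $c$ fixed. *)

(* Defs.v *)
From HB Require Import structures.
From mathcomp Require Import all_boot all_order all_algebra all_fingroup all_solvable.
From mathcomp Require Import all_classical all_reals all_analysis.

Set Implicit Arguments.
Unset Strict Implicit.
Unset Printing Implicit Defensive.

Import Order.TTheory GRing.Theory Num.Theory.
Import numFieldNormedType.Exports.

Local Open Scope ring_scope.

(* A measure on a finite type is represented by its mass function [p];
   the measure of [A] is [\sum_(x in A) p x]. *)

Definition unif (R : realType) (T : finType) (A : {set T}) : T -> R :=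
  fun x => (x \in A)%:R / #|A|%:R.

(* The maximum runs over all events; the default value [0] of the big operator
   is harmless, being the value attained at [A = set0]. *)
Definition tv (R : realType) (T : finType) (p q : T -> R) : R :=
  \big[Num.max/0]_(A : {set T}) `|\sum_(x in A) p x - \sum_(x in A) q x|.

Definition ncycles (n : nat) : {set 'S_n} :=
  [set s : 'S_n | [exists x : 'I_n, porbit s x == [set: 'I_n]%SET]].

Definition transpositions (n : nat) : {set 'S_n} :=
  [set s : 'S_n | [exists i : 'I_n, exists j : 'I_n,
                    (i != j) && (s == tperm i j)]].

(* Law of the [k]-th multiplier, [k >= 1]: the first one is the random n-cycle,
   the others are random transpositions. *)
Definition step_law (R : realType) (n k : nat) : 'S_n -> R :=
  unif R (if k == 1%N then ncycles n else transpositions n).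

(* [X w k] is the state at time [k] when [w j] is the multiplier used at time
   [j.+1].  As [(s * t)%g] maps [x] to [t (s x)], the permutation [X w j * w j]
   is the composite of [X w j] followed by [w j], i.e. [w j] times [X w j] when
   permutations are multiplied as functions. *)
Fixpoint X (n : nat) (w : nat -> 'S_n) (k : nat) : 'S_n :=
  if k is j.+1 then (X w j * w j)%g else 1%g.

(* Law of [X_k]: image under [X] of the product measure on the sequences of
   [k] independent multipliers. *)
Definition mu (R : realType) (n k : nat) : 'S_n -> R :=
  fun s => \sum_(w : k.-tuple 'S_n | X (nth 1%g w) k == s)
             \prod_(i < k) step_law R i.+1 (tnth w i).
Arguments mu R n k s : clear implicits.

Definition U (R : realType) (n k : nat) : 'S_n -> R :=
  unif R (if odd n == odd k then Alt 'I_n else (~: Alt 'I_n)%SET).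
Arguments U R n k s : clear implicits.

(* Main.v *)
(* Let [A] be the permutation matrix of [s]; the coefficients [e_r(s)],
   [0 <= r < n], of [det (1 - X A) / (1 - X)] are, up to the sign [(-1)^r], the
   characters of the hook shapes.  All that is needed about them is elementary.
   Multiplying [s] by a transposition is a rank one perturbation of [A], and
   averaging over all transpositions shows that [e_r] is an eigenfunction of the
   walk, of eigenvalue [a_r = 1 - 2r/(n-1)].  The eigenvalues are distinct and
   the walk is symmetric, so the [e_r] are orthogonal.  The sum of the [e_r] is
   [n] times the indicator of the n-cycles, on which every [e_r] is [1]; hence
   the [e_r] are orthonormal for the uniform measure, and after one n-cycle and
   [m] transpositions the density with respect to it is [\sum_r a_r^m e_r].  The
   terms [r = 0] and [r = n-1] give the uniform measure on the right coset.
   For the upper bound use Cauchy-Schwarz and [a_r^(2m) <= exp(-4mr/(n-1))].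
   For the lower bound test on the derangements: inclusion-exclusion on the fixed
   points gives [e_r] an integral close to [1/(e r!)] over that event, and the
   term [r = 1] alone contributes about [exp(-2c)/e]. *)
Require Import Defs.
From HB Require Import structures.
From mathcomp Require Import all_boot all_order all_algebra all_fingroup all_solvable.
From mathcomp Require Import all_classical all_reals all_analysis.
From mathcomp Require Import ring lra zify.

Import Order.TTheory GRing.Theory Num.Theory.
Import numFieldNormedType.Exports.

Set Implicit Arguments.
Unset Strict Implicit.
Unset Printing Implicit Defensive.

Local Open Scope ring_scope.

(** * The characteristic polynomial of a permutation *)

(** The bordered matrix [big] is reduced to block triangular form in two ways, and comparing
    determinants gives the identity up to the factor [\det B], which is cancelled. The adjugate form
    is the one that makes sense over polynomials, where [B] has no inverse. *)
Lemma det_rank1_update (K : idomainType) n (B : 'M[K]_n) (w : 'cV_n) (v : 'rV_n) :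
  \det B != 0 -> \det (B + w *m v) = \det B + (v *m \adj B *m w) 0 0.
Proof.
move=> dB.
pose big := block_mx B w (- v) 1%:M.
have E1 : big *m block_mx 1%:M 0 v 1%:M = block_mx (B + w *m v) w 0 1%:M.
  rewrite mulmx_block !mulmx1 !mulmx0 !mul1mx !add0r.
  by congr block_mx; rewrite addNr.
have E2 : big *m block_mx 1%:M (- (\adj B *m w)) 0 (\det B)%:M =
   block_mx B 0 (- v) (v *m \adj B *m w + (\det B)%:M).
  rewrite mulmx_block !mulmx1 !mulmx0 !addr0 mul1mx.
  congr block_mx; last by rewrite mulmxN mulNmx opprK mulmxA.
  by rewrite mulmxN mulmxA mul_mx_adj mul_scalar_mx mul_mx_scalar addNr.
move: (congr1 determinant E1) (congr1 determinant E2).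
rewrite !det_mulmx !det_ublock !det_lblock !det1 !mul1r !mulr1 => -> /eqP.
rewrite det_scalar1 mulrC (inj_eq (mulfI dB)) => /eqP ->.
by rewrite [X in \det X]mx11_scalar det_scalar1 !mxE eqxx mulr1n addrC.
Qed.

Lemma deriv_prodr (K : comNzRingType) (I : finType) (F : I -> {poly K}) :
  (\prod_i F i)^`() = \sum_k (F k)^`() * \prod_(i | i != k) F i.
Proof.
pose G k i := if i == k then (F i)^`() else F i.
have -> : \sum_k (F k)^`() * \prod_(i | i != k) F i = \sum_k \prod_i G k i.
  apply: eq_bigr => k _; rewrite [RHS](bigD1 k) //= /G eqxx; congr (_ * _).
  by apply: eq_bigr => i /negbTE ->.
(* The lists must be duplicate-free because [G k] selects the differentiated factor by its index,
   not by its position. *)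
suff H (r : seq I) : uniq r ->
    (\prod_(i <- r) F i)^`() = \sum_(k <- r) \prod_(i <- r) G k i.
  by have := H (index_enum I) (index_enum_uniq I).
elim: r => [|a r IH] /=; first by rewrite !big_nil derivC.
case/andP=> nar /IH{}IH; rewrite !big_cons derivM IH /G eqxx; congr (_ + _).
  congr (_ * _); apply: eq_big_seq => i ir.
  by case: eqP => // ia; rewrite -ia ir in nar.
rewrite big_distrr /=; apply: eq_big_seq => k kr; rewrite big_cons.
by case: eqP => // ak; rewrite ak kr in nar.
Qed.

(** Jacobi's formula. Both sides equal the sum over [k] of the determinants with row [k]
    differentiated: the trace by cofactor expansion along that row, the derivative by the product
    rule in the Leibniz expansion. *)
Lemma deriv_det (K : comNzRingType) n (B : 'M[{poly K}]_n) :
  (\det B)^`() = \tr (map_mx (@deriv K) B *m \adj B).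
Proof.
have -> : \tr (map_mx (@deriv K) B *m \adj B) =
    \sum_k \det (\matrix_(i, j) if i == k then (B i j)^`() else B i j).
  rewrite /mxtrace; apply: eq_bigr => k _.
  rewrite (expand_det_row _ k) !mxE; apply: eq_bigr => j _.
  rewrite !mxE eqxx; congr (_ * _); rewrite /cofactor; congr (_ * \det _).
  apply/matrixP => a b; rewrite !mxE.
  by rewrite eq_sym (negbTE (neq_lift _ _)).
rewrite /determinant raddf_sum /= exchange_big /=; apply: eq_bigr => s _.
rewrite -signr_odd -big_distrr /=; case: (odd_perm s); last first.
  rewrite !mul1r deriv_prodr; apply: eq_bigr => k _.
  rewrite [RHS](bigD1 k) //= mxE eqxx; congr (_ * _).
  by apply: eq_bigr => i /negbTE ik; rewrite mxE ik.
rewrite expr1 !mulN1r derivN deriv_prodr; congr (- _); apply: eq_bigr => k _.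
rewrite [RHS](bigD1 k) //= mxE eqxx; congr (_ * _).
by apply: eq_bigr => i /negbTE ik; rewrite mxE ik.
Qed.

Definition cycle_mx (K : nzRingType) n (s : 'S_n) : 'M[{poly K}]_n :=
  1%:M - 'X *: perm_mx s.

Definition cycle_poly (K : comNzRingType) n (s : 'S_n) : {poly K} :=
  \det (cycle_mx K s).

Lemma perm_mx_ones (K : pzSemiRingType) n (s : 'S_n) :
  perm_mx s *m const_mx 1 = const_mx 1 :> 'cV[K]_n.
Proof. by rewrite -row_permE; apply/matrixP => i j; rewrite !mxE. Qed.

(** This eigenvector is the source of the factor [1 - 'X] of [cycle_poly]. *)
Lemma cycle_mx_ones (K : comNzRingType) n (s : 'S_n) :
  cycle_mx K s *m const_mx 1 = (1 - 'X) *: const_mx 1 :> 'cV_n.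
Proof.
rewrite /cycle_mx mulmxBl mul1mx -scalemxAl perm_mx_ones.
by rewrite scalerBl scale1r.
Qed.

Section CyclePoly.
Variable K : fieldType.

(** With [P] the matrix of [s], one has 1 - X P = - P (X - P^-1). Degree and leading coefficient
    follow from those of [char_poly]. *)
Lemma cycle_polyE n (s : 'S_n) :
  cycle_poly K s = (-1) ^+ n * (-1) ^+ s * char_poly (perm_mx s^-1).
Proof.
rewrite /cycle_poly.
have -> : cycle_mx K s = - (perm_mx s *m char_poly_mx (perm_mx s^-1)).
  rewrite /char_poly_mx map_perm_mx mulmxBr -perm_mxM mulgV perm_mx1.
  by rewrite mul_mx_scalar opprB.
by rewrite -scaleN1r detZ det_mulmx det_perm mulrA.
Qed.

Lemma size_cycle_poly n (s : 'S_n) : size (cycle_poly K s) = n.+1.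
Proof.
rewrite cycle_polyE -mulrA -(signr_odd _ n) !mulr_sign.
by do 2 case: ifP => _; rewrite ?size_polyN ?opprK ?size_char_poly.
Qed.

Lemma lead_coef_cycle_poly n (s : 'S_n) :
  lead_coef (cycle_poly K s) = (-1) ^+ n * (-1) ^+ s.
Proof.
have /monicP m := char_poly_monic (perm_mx s^-1 : 'M[K]_n).
rewrite -[RHS]mulr1 cycle_polyE -!mulrA -!(signr_odd _ n) !mulr_sign.
by do 2 case: ifP => _; rewrite ?lead_coefN ?opprK ?m.
Qed.

Lemma cycle_poly_neq0 n (s : 'S_n) : cycle_poly K s != 0.
Proof. by rewrite -size_poly_eq0 size_cycle_poly. Qed.

Lemma one_subX_neq0 : 1 - 'X != 0 :> {poly K}.
Proof. by rewrite -opprB oppr_eq0 polyXsubC_eq0. Qed.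

Definition hook_poly n (s : 'S_n) : {poly K} := cycle_poly K s %/ (1 - 'X).

(** Applying the adjugate to [cycle_mx_ones] shows that [cycle_poly] is [1 - 'X] times an entry of a
    polynomial vector, so it vanishes at 1. *)
Lemma hook_polyE n (s : 'S_n) : (0 < n)%N ->
  cycle_poly K s = (1 - 'X) * hook_poly s.
Proof.
move=> n0; rewrite mulrC divpK // -opprB dvdpNl -[X in 'X - X]polyC1 dvdp_XsubCl.
have := congr1 (fun A => \adj (cycle_mx K s) *m A) (cycle_mx_ones K s).
rewrite mulmxA mul_adj_mx -scalemxAr mul_scalar_mx.
move/matrixP/(_ (Ordinal n0) 0); rewrite !mxE mulr1 => H.
rewrite rootE /cycle_poly H.
by rewrite hornerM !hornerE subrr mul0r.
Qed.

Lemma size_hook_poly n (s : 'S_n) : (size (hook_poly s) <= n)%N.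
Proof.
rewrite /hook_poly size_divp ?one_subX_neq0 // size_cycle_poly.
by rewrite -opprB size_polyN size_XsubC subn1.
Qed.

Lemma hook_poly0 n (s : 'S_n) : (0 < n)%N -> (hook_poly s)`_0 = 1.
Proof.
have e1 : (1 - 'X : {poly K}).[0] = 1 by rewrite !hornerE ?subr0.
move=> n0; have := congr1 (fun p => p.[0]) (hook_polyE s n0).
rewrite hornerM e1 mul1r -horner_coef0 => <-.
rewrite /cycle_poly -horner_evalE -det_map_mx.
suff -> : map_mx (horner_eval 0) (cycle_mx K s) = 1%:M by rewrite det1.
apply/matrixP => i j; rewrite !mxE /= /horner_eval !hornerE subr0.
by case: eqP; rewrite !hornerE.
Qed.

(** The top coefficient is the sign character up to a constant; it will account for the parity of
    the walk. *)
Lemma hook_poly_last n (s : 'S_n) : (0 < n)%N ->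
  (hook_poly s)`_n.-1 = (-1) ^+ n.-1 * (-1) ^+ s.
Proof.
case: n s => // n s _; have := lead_coef_cycle_poly s.
rewrite lead_coefE size_cycle_poly hook_polyE //= mulrBl mul1r coefB coefXM /=.
rewrite nth_default ?size_hook_poly // sub0r => /eqP.
by rewrite eqr_oppLR exprS -!mulNr opprK mul1r => /eqP.
Qed.
End CyclePoly.

(** * Averaging over transpositions, and full cycles *)

Section TranspositionOperator.
Variable K : fieldType.

(** The case i = j is consistent, [v] being zero, so later sums may run over all ordered pairs. *)
Lemma perm_mx_tperm_rank1 (R : pzRingType) n (i j : 'I_n) :
  let v : 'rV[R]_n := delta_mx 0 i - delta_mx 0 j in
  perm_mx (tperm i j) = 1%:M - v^T *m v.
Proof.
move=> v; apply/matrixP => a b; rewrite !mxE big_ord1 !mxE !eqxx /=.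
case: tpermP => [->|->|/eqP ai /eqP aj].
- rewrite eqxx [b == i]eq_sym [b == j]eq_sym.
  have [->|ij] := eqVneq i j; first by rewrite subrr mul0r subr0.
  by rewrite subr0 mul1r opprB addrC subrK.
- rewrite eqxx [b == i]eq_sym [b == j]eq_sym.
  have [->|ji] := eqVneq j i; first by rewrite subrr mul0r subr0.
  by rewrite sub0r mulN1r opprK addrC subrK.
- by rewrite (negbTE ai) (negbTE aj) subrr mul0r subr0.
Qed.

Lemma sum_transposition_rank1 (R : comPzRingType) n :
  \sum_i \sum_j (let v : 'rV[R]_n := delta_mx 0 i - delta_mx 0 j in v^T *m v) =
  2 *: (n%:R%:M - (const_mx 1 : 'cV_n) *m (const_mx 1 : 'rV_n)).
Proof.
apply/matrixP => a b; rewrite summxE !mxE big_ord1 !mxE mulr1.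
under eq_bigr => i _.
  rewrite summxE; under eq_bigr => j _.
    rewrite !mxE big_ord1 !mxE !eqxx /= mulrBl !mulrBr.
    over.
  rewrite !sumrB sumr_const card_ord.
  rewrite -!big_distrr -!big_distrl /=.
  over.
have S (c : 'I_n) : \sum_j ((c == j)%:R : R) = 1.
  by rewrite (bigD1 c) //= eqxx big1 ?addr0 // => j jc; rewrite eq_sym (negbTE jc).
have S2 : \sum_j ((a == j)%:R * (b == j)%:R : R) = (a == b)%:R.
  rewrite (bigD1 a) //= eqxx big1 ?addr0 ?mul1r 1?eq_sym // => j ja.
  by rewrite eq_sym (negbTE ja) mul0r.
rewrite !sumrB !S sumrMnl S2 sumr_const card_ord.
rewrite -!big_distrl -!big_distrr /= !S.
rewrite -[(_ == _)%:R *+ n]mulr_natr -mulr_natr; case: eqP => _ /=; ring.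
Qed.

(** By [det_rank1_update] each summand is affine in the rank one matrix of the transposition, so
    only the sum of these matrices matters. Its scalar part gives the derivative by Jacobi's
    formula, and its all-ones part gives [hook_poly] because the constant vector is an eigenvector
    of [B]. *)
Lemma sum_cycle_poly_tperm n (s : 'S_n) : (0 < n)%N ->
  \sum_i \sum_j cycle_poly K (s * tperm i j)%g =
  (n ^ 2)%:R * cycle_poly K s
    - (2 * n)%:R * 'X * ((cycle_poly K s)^`() + hook_poly K s).
Proof.
move=> n0; set Q := cycle_poly K s; set B := cycle_mx K s.
pose A : 'M[{poly K}]_n := perm_mx s.
have E i j : cycle_poly K (s * tperm i j)%g = Q + 'X * \tr (\adj B *m A *m
    (let v : 'rV[{poly K}]_n := delta_mx 0 i - delta_mx 0 j in v^T *m v)).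
  rewrite /=; set v : 'rV_n := _ - _.
  have -> : cycle_poly K (s * tperm i j)%g = \det (B + ('X *: A *m v^T) *m v).
    congr (\det _); rewrite /cycle_mx perm_mxM perm_mx_tperm_rank1 -/v.
    by rewrite mulmxBr mulmx1 scalerBr opprB addrCA addrC -mulmxA scalemxAl.
  rewrite det_rank1_update ?cycle_poly_neq0 //; congr (_ + _).
  rewrite mulmxA -scalemxAr -scalemxAl mxE; congr (_ * _).
  rewrite !mulmxA -[LHS]mulr1n -mxtrace_scalar -mx11_scalar.
  by rewrite [RHS]mxtrace_mulC !mulmxA.
under eq_bigr => i _ do under eq_bigr => j _ do rewrite E.
under eq_bigr => i _ do
  rewrite big_split /= sumr_const card_ord -big_distrr -raddf_sum -mulmx_sumr.
rewrite big_split /= sumr_const card_ord -big_distrr -raddf_sum -mulmx_sumr /=.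
rewrite sum_transposition_rank1 -scalemxAr mxtraceZ mulmxBr raddfB /=.
have -> : \tr (\adj B *m A *m n%:R%:M) = - (n%:R * Q^`()).
  have -> : A = - map_mx (@deriv K) B.
    have D (b : bool) : (b%:R : {poly K})^`() = 0 by rewrite derivMn -polyC1 derivC mul0rn.
    apply/matrixP => i j; rewrite !mxE derivB derivM derivX !D.
    by rewrite mulr0 mul1r addr0 sub0r opprK.
  rewrite mul_mx_scalar mxtraceZ -mulrN; congr (_ * _).
  by rewrite mulmxN raddfN /Q /cycle_poly deriv_det mxtrace_mulC.
have -> : \tr (\adj B *m A *m ((const_mx 1 : 'cV_n) *m (const_mx 1 : 'rV_n))) =
    n%:R * hook_poly K s.
  rewrite -mulmxA [A *m _]mulmxA perm_mx_ones.
  apply: (mulfI (one_subX_neq0 K)).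
  rewrite mulrCA -hook_polyE // -mxtraceZ scalemxAr scalemxAl -(cycle_mx_ones _ s).
  rewrite !mulmxA mul_adj_mx -mulmxA mul_scalar_mx mxtraceZ mulrC; congr (_ * _).
  rewrite mxtrace_mulC trace_mx11 !mxE (eq_bigr (fun=> 1)) => [|i _].
    by rewrite sumr_const card_ord.
  by rewrite !mxE mulr1.
rewrite -!mulrnA -mulnn -mulr_natl natrM [(2 * n)%:R]natrM; ring.
Qed.

(* The operator [P |-> n^2 P - 2 n X P'] is diagonal on monomials, so the
   coefficients of [hook_poly] are eigenfunctions of the transposition walk. *)
Lemma sum_hook_poly_tperm n (s : 'S_n) : (0 < n)%N ->
  \sum_i \sum_j hook_poly K (s * tperm i j)%g =
  (n ^ 2)%:R * hook_poly K s - (2 * n)%:R * 'X * (hook_poly K s)^`().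
Proof.
move=> n0; apply: (mulfI (one_subX_neq0 K)).
rewrite big_distrr /=; under eq_bigr => i _.
  rewrite big_distrr /=; under eq_bigr => j _ do rewrite -hook_polyE //.
  over.
rewrite sum_cycle_poly_tperm // hook_polyE // derivM derivB derivC derivX; ring.
Qed.

Lemma sum_hook_coef_tperm n (s : 'S_n) r : (0 < n)%N ->
  \sum_i \sum_j (hook_poly K (s * tperm i j)%g)`_r =
  ((n ^ 2)%:R - (2 * n * r)%:R) * (hook_poly K s)`_r.
Proof.
move=> n0; have := congr1 (fun p : {poly K} => p`_r) (sum_hook_poly_tperm s n0).
rewrite coef_sum; under eq_bigr => i _ do rewrite coef_sum.
move=> ->; rewrite coefB -mulrA !mulr_natl !coefMn coefXM coef_deriv.
case: r => [|r] /=; first by rewrite mul0rn muln0 !subr0 mulr_natl.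
by rewrite -mulrnA mulnC mulrBl !mulr_natl.
Qed.

End TranspositionOperator.

(** * Full cycles and the value of [hook_poly] at 1 *)

Section FullCycles.
Variable K : fieldType.

Lemma porbit_full n (s : 'S_n) x y :
  porbit s x = [set: 'I_n]%SET -> porbit s y = [set: 'I_n]%SET.
Proof.
by move=> sx; rewrite -sx; apply/eqP; rewrite eq_porbit_mem sx inE.
Qed.

(** If [t] moves a point it agrees with [s] there, and injectivity of [t] then forbids fixing the
    next point of the cycle; agreement propagates along the whole orbit. *)
Lemma perm_choice_full_cycle n (s t : 'S_n) x :
    porbit s x = [set: 'I_n]%SET -> (forall i, t i = i \/ t i = s i) ->
  t = 1%g \/ t = s.
Proof.
move=> sx ti.
have [[i0 ti0]|t1] := pselect (exists i, t i != i); last first.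
  left; apply/permP => i; rewrite perm1; apply/eqP/negPn/negP => tii.
  by apply: t1; exists i.
right; apply/permP => i.
have /porbitP[k ->] : i \in porbit s i0 by rewrite (porbit_full _ sx) inE.
suff [] : t ((s ^+ k)%g i0) = s ((s ^+ k)%g i0) /\ s ((s ^+ k)%g i0) != (s ^+ k)%g i0 by [].
elim: k => [|k [IH1 IH2]].
  rewrite expg0 perm1; have [e|e] := ti i0; first by rewrite e eqxx in ti0.
  by split=> //; rewrite -e.
rewrite expgSr permM; split; last by apply: contra IH2 => /eqP /perm_inj ->.
have [e|//] := ti (s ((s ^+ k)%g i0)).
by move: e; rewrite -{2}IH1 => /perm_inj e; rewrite e eqxx in IH2.
Qed.

Lemma full_cycle_moves n (s : 'S_n) x i : (1 < n)%N ->
  porbit s x = [set: 'I_n]%SET -> s i != i.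
Proof.
move=> n1 /(porbit_full i) sx; apply/eqP => si.
have H (y : 'I_n) : y = i.
  have /porbitP[k ->] : y \in porbit s i by rewrite sx inE.
  exact: permX_fix.
by have := H (Ordinal n1); rewrite -[RHS](H (Ordinal (ltnW n1))) => - [].
Qed.

Lemma cycle_poly_full n (s : 'S_n) x : (1 < n)%N ->
  porbit s x = [set: 'I_n]%SET -> cycle_poly K s = 1 - 'X^n.
Proof.
move=> n1 sx; have sm i := full_cycle_moves i n1 sx.
have s1 : s != 1%g by apply/eqP => e; have := sm x; rewrite e perm1 eqxx.
(* A nonzero Leibniz term uses only diagonal entries and entries (i, s i), so by
   [perm_choice_full_cycle] only the identity and [s] contribute. *)
rewrite /cycle_poly /determinant (bigD1 1%g) // (bigD1 s) //= [X in _ + (_ + X)]big1 ?addr0.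
  have -> : (-1) ^+ odd_perm s = (-1) ^+ n.-1 :> {poly K}.
    rewrite /odd_perm card_ord (_ : porbits s = [set [set: 'I_n]%SET]%SET).
      by rewrite cards1 addbT -(prednK (ltnW n1)) /= negbK signr_odd.
    apply/setP => C; rewrite !inE; apply/imsetP/eqP => [[y _ ->]|->].
      exact: porbit_full sx.
    by exists x.
  rewrite odd_perm1 expr0 mul1r; congr (_ + _).
    apply: big1 => i _; rewrite !mxE perm1 eqxx.
    by rewrite (negbTE (sm i)) mulr0 subr0.
  rewrite (eq_bigr (fun=> - 'X)) => [|i _]; last first.
    by rewrite !mxE eqxx eq_sym (negbTE (sm i)) mulr1 sub0r.
  rewrite prodr_const card_ord [(- 'X) ^+ n]exprNn mulrA -exprD.
  by rewrite -{2}(prednK (ltnW n1)) addnS exprS exprD -expr2 sqrr_sign mulr1 mulN1r.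
move=> t /andP[t1 ts].
have [H|H] := pselect (forall i, t i = i \/ t i = s i).
  by have [e|e] := perm_choice_full_cycle sx H; rewrite e eqxx in t1 ts.
have [i Hi] : exists i, ~ (t i = i \/ t i = s i) by apply/existsNP.
rewrite (bigD1 i) //= !mxE.
have [e|_] := eqVneq i (t i); first by case: Hi; left.
have [e|_] := eqVneq (s i) (t i); first by case: Hi; right.
by rewrite mulr0 subr0 mul0r mulr0.
Qed.

Lemma hook_coef_full n (s : 'S_n) x r : (1 < n)%N ->
  porbit s x = [set: 'I_n]%SET -> (r < n)%N -> (hook_poly K s)`_r = 1.
Proof.
move=> n1 sx rn; have := hook_polyE K s (ltnW n1).
rewrite (cycle_poly_full n1 sx) -opprB subrX1 -mulNr opprB => /(mulfI (one_subX_neq0 K)) <-.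
rewrite coef_sum (bigD1 (Ordinal rn)) //= coefXn eqxx big1 ?addr0 // => i ir.
by rewrite coefXn; case: eqP => // e; case/eqP: ir; apply: val_inj.
Qed.

(* Two complementary invariant sets give two independent fixed vectors, hence
   a double zero of [cycle_poly] at [1]. *)
Lemma hook_poly1_not_full n (s : 'S_n) (x : 'I_n) :
  porbit s x != [set: 'I_n]%SET -> (hook_poly K s).[1] = 0.
Proof.
set S := porbit s x => ST.
have n0 : (0 < n)%N by apply: leq_ltn_trans (ltn_ord x).
have aS : x \in S := porbit_id s x.
have [b bS] : exists b, b \notin S.
  apply/existsP; rewrite -negb_forall; apply: contra ST => /forallP H.
  by apply/eqP/setP => y; rewrite H inE.
have sS i : (s i \in S) = (i \in S).
  by rewrite /S -!eq_porbit_mem (porbit_perm s 1 i : porbit s (s i) = _).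
have ab : x != b by apply: contraNneq bS => <-.
(* Right multiplication by 1 + N replaces column [x] by the sum of the columns in [S], and column
   [b] by the sum of those outside [S]. Both sets are invariant, so the two new columns are
   multiples of [1 - 'X]. *)
pose N : 'M[{poly K}]_n := \matrix_(i, j)
  if j == x then (i \in S :\ x)%:R else if j == b then (i \in ~: S :\ b)%:R else 0.
have NN : N *m N = 0.
  apply/matrixP => i j; rewrite !mxE big1 // => k _; rewrite !mxE.
  have [->|_] := eqVneq k x.
    by rewrite !inE eqxx aS /=; case: (j == x); rewrite ?andbF ?if_same mulr0.
  have [->|_] := eqVneq k b; last by rewrite mul0r.
  by rewrite !inE eqxx (negbTE bS) andbF /= if_same; case: (j == x); rewrite mulr0.
have T1 : \det (1%:M + N) * \det (1%:M - N) = 1.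
  rewrite -det_mulmx mulmxBr mulmx1 mulmxDl mul1mx NN addr0.
  by rewrite addrK det1.
pose M : 'M[{poly K}]_n := \matrix_(i, j)
  if j == x then (i \in S)%:R else if j == b then (i \notin S)%:R else cycle_mx K s i j.
pose d : 'rV[{poly K}]_n := \row_j if (j == x) || (j == b) then 1 - 'X else 1.
have E : cycle_mx K s *m (1%:M + N) = M *m diag_mx d.
  have Z (i : 'I_n) (F : {pred 'I_n}) :
      \sum_k cycle_mx K s i k * (k \in F)%:R = (i \in F)%:R - 'X * (s i \in F)%:R.
    under eq_bigr => k _ do rewrite !mxE mulrBl.
    rewrite sumrB; congr (_ - _).
      rewrite (bigD1 i) //= eqxx mul1r big1 ?addr0 // => k ki.
      by rewrite eq_sym (negbTE ki) mul0r.
    rewrite (bigD1 (s i)) //= eqxx mulr1 big1 ?addr0 // => k ki.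
    by rewrite eq_sym (negbTE ki) mulr0 mul0r.
  rewrite mul_mx_diag; apply/matrixP => i j; rewrite !mxE.
  have [->|jx] := eqVneq j x.
    rewrite (eq_bigr (fun k => cycle_mx K s i k * (k \in S)%:R)) => [|k _].
      by rewrite Z sS /= mulrBr mulr1 [X in _ - X]mulrC.
    rewrite !mxE eqxx !inE; have [->|_] := eqVneq k x; first by rewrite aS addr0.
    by rewrite add0r.
  have [->|jb] := eqVneq j b.
    rewrite (eq_bigr (fun k => cycle_mx K s i k * (k \in ~: S)%:R)) => [|k _].
      by rewrite Z !inE sS /= mulrC; case: (i \in S) => /=; ring.
    rewrite !mxE eqxx !inE [b == x]eq_sym (negbTE ab).
    by have [->|_] := eqVneq k b; rewrite ?bS /= ?addr0 ?add0r.
  rewrite /= mulr1 (bigD1 j) //= !mxE eqxx (negbTE jx) (negbTE jb) addr0 mulr1.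
  rewrite big1 ?addr0 // => k kj; rewrite !mxE (negbTE kj) (negbTE jx) (negbTE jb).
  by rewrite addr0 mulr0.
(* The determinant of [diag_mx d] is the square of [1 - 'X]; one factor cancels against
   [hook_polyE], the other vanishes at 1, where det(1 + N) does not by [T1]. *)
have {E} := congr1 determinant E.
rewrite !det_mulmx -/(cycle_poly K s) hook_polyE // det_diag.
rewrite (bigD1 x) // (bigD1 b) 1?eq_sym //= big1 => [|k /andP[kx kb]]; last first.
  by rewrite mxE (negbTE kx) (negbTE kb).
rewrite !mxE !eqxx orbT mulr1 mulrCA -mulrA => /(mulfI (one_subX_neq0 K)).
move/(congr1 (fun p => p.[1])); rewrite !hornerM.
have -> : (1 - 'X : {poly K}).[1] = 0 by rewrite !hornerE subrr.
rewrite mulr0 => /eqP; rewrite mulf_eq0 => /orP[/eqP //|/eqP e].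
move/(congr1 (fun p => p.[1])): T1; rewrite hornerM e mul0r => /esym/eqP.
by rewrite hornerE oner_eq0.
Qed.

Lemma sum_hook_coef n (s : 'S_n) : (1 < n)%N ->
  \sum_(r < n) (hook_poly K s)`_r = n%:R * (s \in ncycles n)%:R.
Proof.
move=> n1; have -> : \sum_(r < n) (hook_poly K s)`_r = (hook_poly K s).[1].
  rewrite (horner_coef_wide _ (size_hook_poly K s)).
  by apply: eq_bigr => r _; rewrite expr1n mulr1.
rewrite inE; case: existsP => [[x /eqP sx]|H] /=.
  rewrite mulr1 (horner_coef_wide _ (size_hook_poly K s)).
  rewrite (eq_bigr (fun=> 1)) ?sumr_const ?card_ord // => r _.
  by rewrite (hook_coef_full n1 sx) // expr1n mulr1.
rewrite mulr0 (@hook_poly1_not_full _ _ (Ordinal (ltnW n1))) //.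
by apply/negP => h; apply: H; exists (Ordinal (ltnW n1)).
Qed.
End FullCycles.

(** * Orthogonality, and the derangement event *)

Section Orthogonality.
Variable R : numFieldType.

(** Transpositions are involutions, so their sum acts as a symmetric operator; eigenfunctions with
    distinct eigenvalues are orthogonal. *)
Lemma hook_coef_orthogonal n r t : (0 < n)%N -> r != t ->
  \sum_(s : 'S_n) (hook_poly R s)`_r * (hook_poly R s)`_t = 0.
Proof.
move=> n0 rt; set S := (X in X = 0).
pose ev k : R := (n ^ 2)%:R - (2 * n * k)%:R.
have E1 : ev r * S = \sum_(s : 'S_n) \sum_i \sum_j
    (hook_poly R (s * tperm i j)%g)`_r * (hook_poly R s)`_t.
  rewrite big_distrr /=; apply: eq_bigr => s _.
  rewrite mulrA -sum_hook_coef_tperm // big_distrl /=.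
  by apply: eq_bigr => i _; rewrite big_distrl.
have E2 : ev t * S = \sum_(s : 'S_n) \sum_i \sum_j
    (hook_poly R s)`_r * (hook_poly R (s * tperm i j)%g)`_t.
  rewrite big_distrr /=; apply: eq_bigr => s _.
  rewrite mulrCA -sum_hook_coef_tperm // big_distrr /=.
  by apply: eq_bigr => i _; rewrite big_distrr.
have E : ev r * S = ev t * S.
  rewrite E1 E2 exchange_big [RHS]exchange_big; apply: eq_bigr => i _ /=.
  rewrite exchange_big [RHS]exchange_big; apply: eq_bigr => j _ /=.
  rewrite (reindex_inj (mulIg (tperm i j))); apply: eq_bigr => s _ /=.
  by rewrite -mulgA tperm2 mulg1.
apply/eqP; move/eqP: E; rewrite -subr_eq0 -mulrBl mulf_eq0 => /orP[|//].
have -> : ev r - ev t = (2 * n * t)%:R - (2 * n * r)%:R by rewrite /ev; ring.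
rewrite subr_eq0 eqr_nat.
by rewrite eqn_pmul2l ?muln_gt0 // eq_sym (negbTE rt).
Qed.

(** This is orthogonality to the coefficient of index 0, which is constantly 1. *)
Lemma sum_hook_coef_perm n r : (0 < n)%N ->
  \sum_(s : 'S_n) (hook_poly R s)`_r = (n`!)%:R * (r == 0)%:R.
Proof.
move=> n0; have [->|r0] := eqVneq r 0%N; last first.
  rewrite mulr0 -[RHS](hook_coef_orthogonal n0 r0).
  by apply: eq_bigr => s _; rewrite hook_poly0 ?mulr1.
rewrite mulr1 (eq_bigr (fun=> 1)) => [|s _]; last exact: hook_poly0.
by rewrite sumr_const card_Sn.
Qed.

(** Summing all coefficients over the group in both orders counts the n-cycles: one order uses
    [sum_hook_coef], and in the other only r = 0 survives. *)
Lemma card_ncycles n : (1 < n)%N -> n%:R * #|ncycles n|%:R = (n`!)%:R :> R.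
Proof.
move=> n1; have n0 := ltnW n1.
transitivity (\sum_(r < n) \sum_(s : 'S_n) (hook_poly R s)`_r).
  rewrite exchange_big /=; under eq_bigr => s _ do rewrite sum_hook_coef //.
  rewrite -big_distrr /= -natr_sum; congr (_ * _%:R).
  by rewrite -sum1_card big_mkcond /=; apply: eq_bigr => s _; case: (s \in _).
rewrite (bigD1 (Ordinal n0)) //= [X in _ + X]big1 => [|r r0].
  by rewrite sum_hook_coef_perm // mulr1 addr0.
rewrite sum_hook_coef_perm // (_ : nat_of_ord r == 0%N = false) ?mulr0 //.
by apply/negP => e; case/eqP: r0; apply: val_inj; apply/eqP.
Qed.

(** By orthogonality one factor may be replaced by the sum of all coefficients, which is [n] on
    n-cycles and 0 elsewhere; on n-cycles the other factor is 1. *)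
Lemma hook_coef_norm n r : (1 < n)%N -> (r < n)%N ->
  \sum_(s : 'S_n) (hook_poly R s)`_r ^+ 2 = (n`!)%:R.
Proof.
move=> n1 rn; have n0 := ltnW n1.
transitivity (\sum_(s : 'S_n) \sum_(t < n) (hook_poly R s)`_r * (hook_poly R s)`_t).
  rewrite exchange_big (bigD1 (Ordinal rn)) //= [X in _ + X]big1 ?addr0 // => t tr.
  apply: hook_coef_orthogonal => //; apply: contra tr => /eqP e.
  by apply/eqP/val_inj.
rewrite -card_ncycles // -sum1_card natr_sum big_distrr [RHS]big_mkcond /=.
apply: eq_bigr => s _; rewrite -big_distrr /= sum_hook_coef //.
case: ifP => [|_]; last by rewrite !mulr0.
by rewrite inE => /existsP[x /eqP sx]; rewrite (hook_coef_full _ n1 sx) // mul1r.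
Qed.

End Orthogonality.

(** * Fixed points and inclusion-exclusion for derangements *)

Section FixedPoints.

Definition nfix n (s : 'S_n) : nat := \sum_(i < n) (s i == i).

Lemma nfix_lift_perm n i (s : 'S_n) : nfix (lift_perm i i s) = (nfix s).+1.
Proof.
rewrite /nfix (bigD1_ord i) //= lift_perm_id eqxx add1n; congr _.+1.
by apply: eq_bigr => j _; rewrite lift_perm_lift (inj_eq lift_inj).
Qed.

Lemma cycle_poly_lift_perm (K : comNzRingType) n i (s : 'S_n) :
  cycle_poly K (lift_perm i i s) = (1 - 'X) * cycle_poly K s.
Proof.
rewrite {1}/cycle_poly (expand_det_row _ i) (bigD1 i) //= big1 ?addr0 => [|j ji].
  rewrite !mxE lift_perm_id !eqxx mulr1; congr (_ * _).
  rewrite /cofactor addnn -signr_odd odd_double mul1r; congr (\det _).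
  apply/matrixP => a b; rewrite !mxE lift_perm_lift.
  by rewrite !(inj_eq lift_inj).
by rewrite !mxE lift_perm_id eq_sym (negbTE ji) mulr0 subr0 mul0r.
Qed.

Lemma big_fix_lift_perm (V : nmodType) n (i : 'I_n.+1) (F : 'S_n.+1 -> V) :
  \sum_(s : 'S_n.+1 | s i == i) F s = \sum_(s : 'S_n) F (lift_perm i i s).
Proof.
have inj : injective (lift_perm i i : 'S_n -> 'S_n.+1).
  move=> s t /permP E; apply/permP => k.
  by have := E (lift i k); rewrite !lift_perm_lift => /lift_inj.
rewrite -(big_imset _ (in2W inj)) /=; apply: eq_bigl => s.
apply/eqP/idP => [si|/imsetP[t _ ->]]; last exact: lift_perm_id.
suff /eqP -> : [set lift_perm i i x | x in xpredT]%SET == [set s : 'S_n.+1 | s i == i]%SET.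
  by rewrite inE si.
rewrite eqEcard; apply/andP; split.
  by apply/fintype.subsetP => _ /imsetP[t _ ->]; rewrite inE lift_perm_id.
rewrite card_imset // card_Sn.
(* Surjectivity by counting: the stabilizer of [i] consists of permutations supported off [i], and
   there are [n!] of those. *)
have -> : n`! = (#|[set~ i]%SET|)`! by rewrite cardsC1 card_ord.
rewrite -card_perm.
apply/subset_leq_card/fintype.subsetP => t; rewrite !inE => /eqP ti.
by apply/fintype.subsetP => k; rewrite !inE; apply: contra => /eqP ->; rewrite ti.
Qed.

Variable K : numFieldType.

(** Absorption turns (j+1) C(f, j+1) into f C(f-1, j), and the factor f into a choice of fixed
    point. Deleting that point lowers [nfix] by one and divides [cycle_poly] by [1 - 'X]. *)
Lemma fix_moment_rec n j :
  j.+1%:R * (\sum_(s : 'S_n.+1) 'C(nfix s, j.+1)%:R * cycle_poly K s) =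
  n.+1%:R * (1 - 'X) * \sum_(s : 'S_n) 'C(nfix s, j)%:R * cycle_poly K s.
Proof.
rewrite big_distrr /=.
transitivity (\sum_(s : 'S_n.+1) \sum_(i < n.+1 | s i == i)
   'C((nfix s).-1, j)%:R * cycle_poly K s).
  apply: eq_bigr => s _; rewrite mulrA -natrM -mul_bin_diag natrM -mulrA.
  rewrite {1}/nfix natr_sum big_distrl [RHS]big_mkcond /=; apply: eq_bigr => i _.
  by case: eqP; rewrite ?mul1r ?mul0r.
rewrite (exchange_big_dep xpredT) //=.
under eq_bigr => i _.
  rewrite big_fix_lift_perm.
  under eq_bigr => s _ do
    rewrite nfix_lift_perm cycle_poly_lift_perm mulrCA.
  rewrite -big_distrr /=; over.
by rewrite /= sumr_const card_ord -[LHS]mulr_natl mulrA.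
Qed.

(** Deleting j fixed points leads to the mean of [cycle_poly] over the permutations of n - j points.
    That mean is [1 - 'X], except for j = n, where the empty permutation gives 1; hence the
    [minn]. *)
Lemma fix_moment n j : (j <= n)%N ->
  (j`!)%:R * (\sum_(s : 'S_n) 'C(nfix s, j)%:R * cycle_poly K s) =
  (n`!)%:R * (1 - 'X) ^+ minn j.+1 n.
Proof.
elim: j n => [|j IH] [|n] //.
- move=> _; rewrite !mul1r (eq_bigr (fun=> 1)) => [|s _].
    by rewrite sumr_const card_Sn.
  by rewrite bin0 mul1r /cycle_poly det_mx00.
- move=> _; rewrite mul1r minnSS min0n expr1.
  under eq_bigr => s _ do rewrite bin0 mul1r hook_polyE //.
  rewrite -big_distrr mulrC /=; congr (_ * _).
  apply/polyP => r; rewrite coef_sum sum_hook_coef_perm //.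
  by rewrite -polyC_natr coefC; case: eqP => _; rewrite ?mulr1 ?mulr0.
move=> /= jn; rewrite factS mulnC natrM -mulrA fix_moment_rec.
rewrite mulrCA IH // [in RHS]minnSS factS natrM exprS; ring.
Qed.

Lemma alternating_bin_sum n f : (f <= n)%N ->
  \sum_(j < n.+1) (-1) ^+ j * 'C(f, j)%:R = (f == 0%N)%:R :> K.
Proof.
move=> fn; rewrite -[RHS](_ : (1 - 1) ^+ f = _); last by rewrite subrr expr0n.
rewrite exprBn.
rewrite (big_ord_widen_cond n.+1 xpredT
  (fun j => ((-1) ^+ j * 1 ^+ (f - j) * 1 ^+ j) *+ 'C(f, j) : K)) //.
rewrite [RHS]big_mkcond /=; apply: eq_bigr => j _.
rewrite !expr1n !mulr1; case: ltnP => jf; first by rewrite mulr_natr.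
by rewrite bin_small ?mulr0.
Qed.

Lemma nfix_leq n (s : 'S_n) : (nfix s <= n)%N.
Proof.
rewrite /nfix -[X in (_ <= X)%N]card_ord -sum1_card.
by apply: leq_sum => i _; case: eqP.
Qed.

Definition derangements n : {set 'S_n} := [set s : 'S_n | nfix s == 0%N]%SET.

(** The indicator of no fixed point is an alternating sum of the C(nfix, j); each of these is
    averaged by [fix_moment], and one factor [1 - 'X] is cancelled. *)
Lemma sum_hook_poly_derangements n :
  \sum_(s in derangements n.+1) hook_poly K s =
  \sum_(j < n.+2) ((-1) ^+ j * (n.+1)`!%:R / j`!%:R)%:P * (1 - 'X) ^+ minn j n.
Proof.
apply: (mulfI (one_subX_neq0 K)); rewrite !big_distrr /=.
transitivity (\sum_(s : 'S_n.+1) \sum_(j < n.+2)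
    ((-1) ^+ j)%:P * ('C(nfix s, j)%:R * cycle_poly K s)).
  rewrite big_mkcond /=; apply: eq_bigr => s _.
  have -> : \sum_(j < n.+2) ((-1) ^+ j)%:P * ('C(nfix s, j)%:R * cycle_poly K s) =
     (\sum_(j < n.+2) (-1) ^+ j * 'C(nfix s, j)%:R)%:P * cycle_poly K s.
    rewrite rmorph_sum big_distrl; apply: eq_bigr => j _ /=.
    by rewrite polyCM polyC_natr mulrA.
  rewrite alternating_bin_sum ?nfix_leq // inE; case: eqP => _.
    by rewrite polyC1 mul1r hook_polyE.
  by rewrite mul0r.
rewrite exchange_big; apply: eq_bigr => j _ /=; rewrite -big_distrr /=.
have j0 : (j`!%:R : K) != 0 by rewrite pnatr_eq0 -lt0n fact_gt0.
have j0' : (j`!%:R : {poly K}) != 0 by rewrite -polyC_natr polyC_eq0.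
apply: (mulfI j0'); rewrite mulrCA fix_moment -1?ltnS ?ltn_ord //.
rewrite minnSS exprS [RHS]mulrCA [j`!%:R * (_ * _)]mulrA.
have -> : j`!%:R * ((-1) ^+ j * (n.+1)`!%:R / j`!%:R)%:P =
    ((-1) ^+ j)%:P * (n.+1)`!%:R :> {poly K}.
  by rewrite -!polyC_natr -!polyCM mulrC divfK.
ring.
Qed.

Lemma coef_exp_one_subX k r : (((1 - 'X) ^+ k : {poly K})`_r) = (-1) ^+ r * 'C(k, r)%:R.
Proof.
have -> : (1 - 'X) ^+ k = \poly_(i < k.+1) ((-1) ^+ i * 'C(k, i)%:R) :> {poly K}.
  rewrite poly_def exprBn; apply: eq_bigr => i _.
  rewrite expr1n mulr1 -mul_polyC rmorphM rmorphXn rmorphN /= polyC1 polyC_natr.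
  by rewrite -mulrA mulr_natl mulrnAr.
by rewrite coef_poly ltnS; case: leqP => // kr; rewrite bin_small ?mulr0.
Qed.

Definition exp_trunc n : K := \sum_(i < n) (-1) ^+ i / i`!%:R.

Lemma sum_hook_coef_derangements n r : (r <= n)%N ->
  (\sum_(s in derangements n.+1) (hook_poly K s)`_r) / (n.+1)`!%:R =
  exp_trunc (n.+1 - r) / r`!%:R + (-1) ^+ (n.+1 + r) * 'C(n, r)%:R / (n.+1)`!%:R.
Proof.
move=> rn; rewrite -coef_sum sum_hook_poly_derangements coef_sum big_distrl.
have f0 k : (k`!%:R : K) != 0 by rewrite pnatr_eq0 -lt0n fact_gt0.
(* The term j = n + 1 is set apart: there the [minn] truncates the exponent to n, which gives the
   correction term. *)
rewrite big_ord_recr /=; congr (_ + _); last first.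
  rewrite coefCM coef_exp_one_subX (minn_idPr (leqnSn n)) exprD -!mulrA.
  by rewrite mulrA; field; rewrite f0.
transitivity (\sum_(j < n.+1) (-1) ^+ (j + r) * 'C(j, r)%:R / j`!%:R : K).
  apply: eq_bigr => j _; rewrite coefCM coef_exp_one_subX.
  have /minn_idPl -> : (j <= n)%N by rewrite -ltnS.
  by rewrite exprD; field; rewrite !f0.
rewrite -(big_mkord xpredT (fun j => (-1) ^+ (j + r) * 'C(j, r)%:R / j`!%:R : K)).
rewrite (big_cat_nat (n := r)) //=; last exact: leqW.
rewrite big_nat_cond big1 ?add0r; last first.
  by move=> j /andP[/andP[_ jr] _]; rewrite bin_small // mulr0 mul0r.
(* After the shift j = i + r, the quotient C(j, r) / j! is 1 / (r! i!), and the signs combine to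
   that of i. *)
rewrite -{1}[r]add0n big_addn big_mkord /exp_trunc big_distrl.
apply: eq_bigr => i _ /=.
have := bin_fact (leq_addl i r); rewrite addnK => /(congr1 (fun k => k%:R : K)).
rewrite !natrM => e.
rewrite -addnA exprD addnn -muln2 exprM sqrr_sign mulr1 -e.
field; rewrite !f0 /=.
by apply/eqP => b0; have := f0 (i + r)%N; rewrite -e b0 mul0r eqxx.
Qed.

End FixedPoints.

(** * Spectral formula for the law of the walk *)

Section Walk.
Variable R : realType.

Lemma eq_X n (v w : nat -> 'S_n) k :
  (forall j, (j < k)%N -> v j = w j) -> X v k = X w k.
Proof.
elim: k => //= k IH vw; rewrite vw // IH // => j jk.
by apply: vw; apply: ltnW.
Qed.

Lemma rcons_tuple_bij (T : finType) k :
  bijective (fun p : k.-tuple T * T => [tuple of rcons p.1 p.2]).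
Proof.
apply: inj_card_bij => [[u x] [v y] /(congr1 val) /= /rcons_inj [e ->]|].
  by congr (_, _); apply: val_inj.
by rewrite card_tuple card_prod card_tuple expnSr.
Qed.

(** Markov property, by splitting off the last multiplier. *)
Lemma mu_succ n k (s : 'S_n) :
  mu R n k.+1 s = \sum_(t : 'S_n) mu R n k (s * t^-1)%g * step_law R k.+1 t.
Proof.
rewrite /mu (reindex _ (onW_bij _ (rcons_tuple_bij _ _))) /=.
pose F (w : k.-tuple 'S_n) (t : 'S_n) : R := if X (nth 1%g w) k == (s * t^-1)%g then
   (\prod_(i < k) step_law R i.+1 (tnth w i)) * step_law R k.+1 t else 0.
transitivity (\sum_(p : k.-tuple 'S_n * 'S_n) F p.1 p.2).
  rewrite big_mkcond /=; apply: eq_bigr => -[w t] _ /=; rewrite /F.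
  have -> : X (nth 1%g (rcons w t)) k = X (nth 1%g w) k.
    by apply: eq_X => j jk; rewrite nth_rcons size_tuple jk.
  rewrite nth_rcons size_tuple ltnn eqxx (can2_eq (mulgK t) (mulgKV t)).
  case: eqP => // _; rewrite big_ord_recr /=; congr (_ * _).
    apply: eq_bigr => i _; congr (step_law _ _ _).
    by rewrite !(tnth_nth 1%g) /= nth_rcons size_tuple ltn_ord.
  by congr (step_law _ _ _); rewrite (tnth_nth 1%g) /= nth_rcons size_tuple ltnn eqxx.
rewrite -(pair_bigA _ F) exchange_big; apply: eq_bigr => t _ /=.
by rewrite big_distrl [RHS]big_mkcond.
Qed.

Lemma mu1 n (s : 'S_n) : mu R n 1 s = unif R (ncycles n) s.
Proof.
rewrite mu_succ (bigD1 s) //= big1 ?addr0 => [|t ts].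
  rewrite mulgV /mu (big_pred1 [tuple]) => [|w]; first by rewrite big_ord0 mul1r.
  by rewrite /= [w]tuple0 [RHS]eqxx eqxx.
rewrite /mu big1 ?mul0r // => w /= /eqP e.
by case/eqP: ts; rewrite -[t]mul1g e mulgKV.
Qed.

Lemma mem_transpositions n (i j : 'I_n) : i != j -> tperm i j \in transpositions n.
Proof.
move=> ij; rewrite inE; apply/existsP; exists i.
by apply/existsP; exists j; rewrite ij eqxx.
Qed.

Lemma transpositionsP n (t : 'S_n) :
  reflect (exists2 p : 'I_n * 'I_n, p.1 != p.2 & t = tperm p.1 p.2) (t \in transpositions n).
Proof.
apply: (iffP idP) => [|[[i j] /= ij ->]]; last exact: mem_transpositions.
rewrite inE => /existsP[i /existsP[j /andP[ij /eqP ->]]].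
by exists (i, j).
Qed.

Lemma tperm_eq n (a b i j : 'I_n) : a != b -> i != j ->
  (tperm i j == tperm a b) = ((i, j) == (a, b)) || ((i, j) == (b, a)).
Proof.
move=> ab ij; rewrite !xpair_eqE; apply/eqP/orP; last first.
  case=> /andP[/eqP -> /eqP ->]; first by [].
  exact: tpermC.
move=> e; have := tpermL i j; rewrite {}e.
case: tpermP => [-> <-|-> <-|_ _ e']; first by left; rewrite !eqxx.
  by right; rewrite !eqxx.
by rewrite e' eqxx in ij.
Qed.

Lemma sum_tperm (V : nmodType) n (F : 'S_n -> V) :
  \sum_i \sum_j F (tperm i j) = F 1%g *+ n + (\sum_(t in transpositions n) F t) *+ 2.
Proof.
rewrite pair_bigA (bigID (fun p => p.1 == p.2)) /=; congr (_ + _).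
  rewrite (reindex_onto (fun i : 'I_n => (i, i)) fst) /=; last first.
    by move=> [i j] /= /eqP ->.
  rewrite (eq_bigr (fun=> F 1%g)) => [|i _]; last by rewrite tperm1.
  by rewrite (eq_bigl xpredT) ?sumr_const ?card_ord // => i; rewrite !eqxx.
rewrite (partition_big (fun p => tperm p.1 p.2) (mem (transpositions n))) /=; last first.
  by move=> [i j] /=; exact: mem_transpositions.
rewrite -sumrMnl; apply: eq_bigr => t /transpositionsP[[a b] /= ab ->].
rewrite (eq_bigr (fun=> F (tperm a b))) => [|p /andP[_ /eqP -> //]].
rewrite (bigD1 (a, b)) /= ?ab ?eqxx // (bigD1 (b, a)) /=; last first.
  by rewrite eq_sym ab tpermC eqxx xpair_eqE negb_and eq_sym ab.
rewrite big1 ?addr0 // => -[i j] /andP[/andP[/andP[/= ij]]].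
by rewrite tperm_eq // => /orP[] /eqP -> ; rewrite ?eqxx.
Qed.

Definition hook_eigenvalue n r : R := 1 - (2 * r)%:R / n.-1%:R.

Lemma card_transpositions n : (0 < n)%N ->
  (#|transpositions n|%:R * 2 = n%:R * n.-1%:R :> R).
Proof.
move=> n0; have := sum_tperm (fun=> 1 : R) (n := n).
under eq_bigr => i _ do rewrite sumr_const card_ord.
rewrite !sumr_const card_ord -[_ *+ n *+ n]mulr_natr -[_ *+ 2]mulr_natr => e.
apply: (addrI n%:R); rewrite -{}e.
have -> : (n%:R : R) = n.-1%:R + 1 by rewrite natr1 prednK.
ring.
Qed.

(** The sum over ordered pairs contains the identity n times and each transposition twice; removing
    the identity part turns n^2 - 2nr into n(n-1) times the eigenvalue. *)
Lemma sum_hook_coef_transpositions n (s : 'S_n) r : (1 < n)%N ->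
  \sum_(t in transpositions n) (hook_poly R (s * t)%g)`_r =
  #|transpositions n|%:R * hook_eigenvalue n r * (hook_poly R s)`_r.
Proof.
move=> n1; have n0 := ltnW n1.
have := sum_hook_coef_tperm R s r n0.
rewrite (sum_tperm (fun t => (hook_poly R (s * t)%g)`_r)) mulg1.
rewrite -[_ *+ n]mulr_natr -[_ *+ 2]mulr_natr.
set S := \sum_(t in _) _; set e := _`_r => E.
have n1' : (n.-1%:R : R) != 0 by rewrite pnatr_eq0 -lt0n -ltnS prednK.
have two : (2 : R) != 0 by rewrite pnatr_eq0.
apply: (mulIf two); rewrite mulrAC [_ * hook_eigenvalue n r * 2]mulrAC card_transpositions //.
apply: (addrI (e * n%:R)); rewrite E /hook_eigenvalue natrX !natrM.
have -> : (n%:R : R) = n.-1%:R + 1 by rewrite natr1 prednK.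
by field.
Qed.

(** Initially [sum_hook_coef] expands the indicator of the n-cycles with all weights 1; each
    transposition then multiplies the weights by the eigenvalues. *)
Lemma mu_hook n m (s : 'S_n) : (1 < n)%N ->
  mu R n m.+1 s =
  (\sum_(0 <= r < n) hook_eigenvalue n r ^+ m * (hook_poly R s)`_r) / (n`!)%:R.
Proof.
move=> n1; have n0 := ltnW n1.
have n0' : (n%:R : R) != 0 by rewrite pnatr_eq0 -lt0n.
have f0 : (n`!%:R : R) != 0 by rewrite pnatr_eq0 -lt0n fact_gt0.
elim: m s => [|m IH] s.
  rewrite mu1 /unif -(card_ncycles R n1) big_mkord.
  under eq_bigr => r _ do rewrite expr0 mul1r.
  by rewrite sum_hook_coef // invfM mulrACA divff // mul1r.
have t0 : (#|transpositions n|%:R : R) != 0.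
  apply/eqP => e; have := card_transpositions n0; rewrite e mul0r => /esym/eqP.
  rewrite mulf_eq0 (negbTE n0') pnatr_eq0 /= => /eqP e1.
  by move: n1; rewrite -(prednK n0) e1.
rewrite mu_succ /step_law /unif /=.
transitivity (\sum_(t in transpositions n) mu R n m.+1 (s * t)%g / #|transpositions n|%:R).
  rewrite [RHS]big_mkcond /=; apply: eq_bigr => t _; case: ifP => [|_]; last first.
    by rewrite mul0r mulr0.
  by move=> /transpositionsP[p _ ->]; rewrite tpermV mul1r.
rewrite -big_distrl /=; under eq_bigr => t _ do rewrite IH.
rewrite -big_distrl /= mulrAC; congr (_ / _).
rewrite exchange_big big_distrl /=; apply: eq_bigr => r _.
rewrite -big_distrr /= sum_hook_coef_transpositions // exprSr.
by field.
Qed.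

End Walk.

(** * Bounds at fixed size *)

Lemma sum_mul_sqr_le (F : realFieldType) (I : finType) (f g : I -> F) :
  (\sum_i f i * g i) ^+ 2 <= (\sum_i f i ^+ 2) * (\sum_i g i ^+ 2).
Proof.
(* Lagrange's identity. *)
have : 0 <= \sum_i \sum_j (f i * g j - f j * g i) ^+ 2.
  by apply: sumr_ge0 => i _; apply: sumr_ge0 => j _; apply: sqr_ge0.
have -> : \sum_i \sum_j (f i * g j - f j * g i) ^+ 2 =
    2 * ((\sum_i f i ^+ 2) * (\sum_i g i ^+ 2) - (\sum_i f i * g i) ^+ 2).
  transitivity (\sum_i \sum_j f i ^+ 2 * g j ^+ 2
     + \sum_i \sum_j g i ^+ 2 * f j ^+ 2
     - 2 * \sum_i \sum_j (f i * g i) * (f j * g j)).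
    rewrite big_distrr -big_split -sumrB; apply: eq_bigr => i _ /=.
    rewrite big_distrr -big_split -sumrB; apply: eq_bigr => j _ /=; ring.
  rewrite -!big_distrlr /=; ring.
by rewrite pmulr_rge0 // subr_ge0.
Qed.

Section TotalVariation.
Variables (R : realType) (T : finType).

Lemma tv_le (p q : T -> R) b : 0 <= b ->
  (forall A : {set T}, `|\sum_(x in A) (p x - q x)| <= b) -> tv p q <= b.
Proof.
move=> b0 H; apply: bigmax_le => // A _.
by rewrite -sumrB.
Qed.

Lemma tv_ge (p q : T -> R) (A : {set T}) : \sum_(x in A) (p x - q x) <= tv p q.
Proof.
rewrite sumrB; apply: le_trans (ler_norm _) _.
exact: (le_bigmax _ (fun A : {set T} => `|\sum_(x in A) p x - \sum_(x in A) q x|) A).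
Qed.
End TotalVariation.

Section Deviation.
Variable R : realType.
Variables (n m : nat).
Hypothesis n1 : (1 < n)%N.

Let n0 : (0 < n)%N := ltnW n1.
Local Notation e r s := ((hook_poly R s)`_r).
Local Notation a := (hook_eigenvalue R n).

Lemma fact_neq0 k : (k`!%:R : R) != 0.
Proof. by rewrite pnatr_eq0 -lt0n fact_gt0. Qed.

Lemma pred_neq0 : (n.-1%:R : R) != 0.
Proof. by rewrite pnatr_eq0 -lt0n ltn_predRL. Qed.

Lemma hook_eigenvalue0 : a 0 = 1.
Proof. by rewrite /hook_eigenvalue muln0 mul0r subr0. Qed.

Lemma hook_eigenvalue_last : a n.-1 = -1.
Proof. by rewrite /hook_eigenvalue natrM mulfK ?pred_neq0 //; ring. Qed.

(** This is the term r = n - 1 of the spectral formula: 1 on the coset reached after the n-cycle and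
    [m] transpositions, -1 off it. *)
Definition coset_sign (s : 'S_n) : R := (-1) ^+ m * e n.-1 s.

Lemma coset_signE s : coset_sign s = (-1) ^+ (odd m (+) odd n.-1 (+) odd_perm s).
Proof.
by rewrite /coset_sign hook_poly_last // !signr_addb !signr_odd !mulrA.
Qed.

Lemma coset_sign_sqr s : coset_sign s ^+ 2 = 1.
Proof. by rewrite coset_signE sqrr_sign. Qed.

Lemma U_hook s : U R n m.+1 s = (1 + coset_sign s) / (n`!)%:R.
Proof.
have cA : #|Alt 'I_n|%:R = (n`!)%:R / 2 :> R.
  have := @card_Alt 'I_n; rewrite card_ord => /(_ n1) <-.
  by rewrite natrM mulrC mulKf.
have cC : #|~: Alt 'I_n|%:R = (n`!)%:R / 2 :> R.
  have := cardsC (Alt 'I_n); rewrite card_Sn => /(congr1 (fun k => k%:R : R)).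
  rewrite natrD cA => e1; apply: (addrI (n`!%:R / 2)); rewrite e1; by field.
have on : odd n = ~~ odd n.-1 by rewrite -{1}(prednK n0).
rewrite coset_signE /U /unif on /= (inj_eq negb_inj).
case: (odd n.-1); case: (odd m) => /=; rewrite ?finset.in_setC Alt_even ?cA ?cC;
  case: (odd_perm s) => /=;
  rewrite ?expr0 ?expr1 ?subrr ?mul0r //; field; rewrite fact_neq0 //.
Qed.

Definition deviation (s : 'S_n) : R :=
  (\sum_(1 <= r < n.-1) a r ^+ m * e r s) / (n`!)%:R.

Lemma mu_sub_U s : mu R n m.+1 s - U R n m.+1 s = deviation s.
Proof.
rewrite mu_hook // U_hook -mulrBl /deviation; congr (_ / _).
rewrite -{1}(prednK n0) big_nat_recr //= big_ltn ?ltn_predRL //.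
rewrite hook_eigenvalue0 hook_eigenvalue_last expr1n mul1r hook_poly0 //.
by rewrite -[_ * _`_n.-1]/(coset_sign s); ring.
Qed.

Lemma sum_deviation_hook t : (t = 0 \/ t = n.-1)%N -> \sum_s deviation s * e t s = 0.
Proof.
move=> t0; under eq_bigr => s _ do rewrite mulrAC big_distrl.
rewrite -big_distrl exchange_big /= big_nat_cond big1 ?mul0r // => r.
rewrite andbT => /andP[r0 rn].
under eq_bigr => s _ do rewrite -mulrA.
rewrite -big_distrr /= hook_coef_orthogonal ?mulr0 //.
by case: t0 => ->; rewrite ?neq_ltn ?rn // -lt0n.
Qed.

Lemma sum_deviation : \sum_s deviation s = 0.
Proof.
rewrite -[RHS](sum_deviation_hook (or_introl (erefl 0%N))).
by apply: eq_bigr => s _; rewrite hook_poly0 ?mulr1.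
Qed.

Lemma sum_deviation_sign : \sum_s deviation s * coset_sign s = 0.
Proof.
under eq_bigr => s _ do rewrite /coset_sign mulrCA.
by rewrite -big_distrr /= sum_deviation_hook ?mulr0 //; right.
Qed.

Lemma mu_ge0 k s : 0 <= mu R n k s.
Proof.
apply: sumr_ge0 => w _; apply: prodr_ge0 => i _.
by apply: divr_ge0; apply: ler0n.
Qed.

(* Off the coset [U] vanishes, so the deviation is nonnegative there, and its
   sum over the complement of the coset is zero. *)
Lemma deviation_sign s : deviation s * coset_sign s = deviation s.
Proof.
have pos x : 0 <= deviation x * (1 - coset_sign x).
  have [c1|c1] : coset_sign x = 1 \/ coset_sign x = -1.
    by rewrite coset_signE; case: (_ (+) _); [right|left]; rewrite ?expr1 ?expr0.
    by rewrite c1 subrr mulr0.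
  rewrite -mu_sub_U U_hook c1 subrr mul0r subr0 mulr_ge0 ?mu_ge0 //; lra.
have S0 : \sum_x deviation x * (1 - coset_sign x) = 0.
  under eq_bigr => x _ do rewrite mulrBr mulr1.
  by rewrite sumrB sum_deviation sum_deviation_sign subrr.
have /eqP := @psumr_eq0P R _ xpredT _ (fun x _ => pos x) S0 s isT.
by rewrite mulrBr mulr1 subr_eq0 => /eqP.
Qed.

(** Parseval's identity for the [hook_poly] coefficients. *)
Lemma sum_deviation_sqr :
  \sum_s deviation s ^+ 2 = (\sum_(1 <= r < n.-1) a r ^+ (2 * m)) / (n`!)%:R.
Proof.
transitivity (\sum_(s : 'S_n) (\sum_(1 <= r < n.-1) \sum_(1 <= t < n.-1)
    a r ^+ m * a t ^+ m * (e r s * e t s)) / (n`!)%:R ^+ 2).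
  apply: eq_bigr => s _; rewrite /deviation expr_div_n; congr (_ / _).
  rewrite expr2 big_distrlr /=; apply: eq_bigr => r _; apply: eq_bigr => t _.
  by rewrite mulrACA.
rewrite -big_distrl exchange_big /=.
have -> : \sum_(1 <= r < n.-1) \sum_(s : 'S_n) \sum_(1 <= t < n.-1)
    a r ^+ m * a t ^+ m * (e r s * e t s) =
   (\sum_(1 <= r < n.-1) a r ^+ (2 * m)) * (n`!)%:R.
  rewrite big_distrl; apply: eq_big_nat => r /andP[r0 rn].
  have rn' : (r < n)%N by apply: leq_trans rn (leq_pred _).
  rewrite exchange_big /= (bigD1_seq r) ?mem_index_iota ?iota_uniq ?r0 //=.
  rewrite [X in _ + X]big1 => [|t tr].
    rewrite addr0 -big_distrr /= mul2n -addnn exprD; congr (_ * _).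
    by rewrite -(hook_coef_norm R n1 rn').
  rewrite -big_distrr /= hook_coef_orthogonal ?mulr0 //.
  by rewrite eq_sym.
by field; rewrite fact_neq0.
Qed.

Lemma sum_deviation_set_sqr (A : {set 'S_n}) :
  (\sum_(s in A) deviation s) ^+ 2 <= (\sum_(1 <= r < n.-1) a r ^+ (2 * m)) / 8.
Proof.
(* The indicator of [A] is centred at 1/2, as [deviation] has sum zero, and restricted to the coset
   carrying [deviation]. Then [h] is 1/2 in absolute value on half the group, which gives the
   constant 1/8 in Cauchy-Schwarz. *)
pose h s : R := ((s \in A)%:R - 2^-1) * ((1 + coset_sign s) / 2).
have -> : \sum_(s in A) deviation s = \sum_s h s * deviation s.
  transitivity (\sum_s ((s \in A)%:R * deviation s - 2^-1 * deviation s)).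
    rewrite sumrB -big_distrr /= sum_deviation mulr0 subr0 big_mkcond /=.
    by apply: eq_bigr => s _; case: (s \in A); rewrite ?mul1r ?mul0r.
  apply: eq_bigr => s _; rewrite /h -mulrBl -mulrA; congr (_ * _).
  by rewrite mulrAC mulrDl mul1r [_ * deviation s]mulrC deviation_sign; field.
apply: le_trans (sum_mul_sqr_le _ _) _.
have -> : \sum_s h s ^+ 2 = (n`!)%:R / 8.
  transitivity (\sum_s (8^-1 + 8^-1 * coset_sign s)).
    apply: eq_bigr => s _; rewrite /h !exprMn.
    have -> : (1 + coset_sign s) ^+ 2 = 2 + 2 * coset_sign s.
      by rewrite sqrrD coset_sign_sqr; ring.
    by case: (s \in A); rewrite /= ?mulr1n ?mulr0n; field.
  rewrite big_split -big_distrr -big_distrr /= sumr_const card_Sn.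
  rewrite sum_hook_coef_perm // gtn_eqF ?ltn_predRL //.
  by rewrite -[8^-1 *+ _]mulr_natl !mulr0 addr0.
rewrite sum_deviation_sqr mulrC mulrA divfK ?fact_neq0 //.
Qed.

(** The absolute value of the eigenvalue is 1 - 2k/(n-1) with k = r or k = n-1-r according to its
    sign, and 1 - x <= exp(-x). Adding both bounds avoids cutting the sum at the middle. *)
Lemma eigenvalue_pow_le r : (0 < r < n.-1)%N ->
  a r ^+ (2 * m) <= expR (- (4 * m%:R / n.-1%:R)) ^+ r
                  + expR (- (4 * m%:R / n.-1%:R)) ^+ (n.-1 - r).
Proof.
move=> /andP[r0 rn]; have N0 : 0 < (n.-1%:R : R) by rewrite ltr0n ltn_predRL.
have bound k x : 0 <= x -> x <= 1 - 2 * k%:R / n.-1%:R ->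
    x ^+ (2 * m) <= expR (- (4 * m%:R / n.-1%:R)) ^+ k.
  move=> x0 xk; apply: (@le_trans _ _ (expR (- (2 * k%:R / n.-1%:R)) ^+ (2 * m))).
    apply: lerXn2r; rewrite ?nnegrE ?expR_ge0 //.
    exact: le_trans xk (expR_ge1Dx _).
  by rewrite -!expRM_natl natrM (_ : _ * _ = k%:R * - (4 * m%:R / n.-1%:R)) //; ring.
have [a0|a0] := leP 0 (a r).
  apply: (@le_trans _ _ (expR (- (4 * m%:R / n.-1%:R)) ^+ r)).
    by apply: bound => //; rewrite /hook_eigenvalue natrM.
  by rewrite lerDl exprn_ge0 // expR_ge0.
apply: (@le_trans _ _ (expR (- (4 * m%:R / n.-1%:R)) ^+ (n.-1 - r))); last first.
  by rewrite lerDr exprn_ge0 // expR_ge0.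
rewrite exprM -sqrrN -exprM; apply: bound; first by rewrite oppr_ge0 ltW.
rewrite /hook_eigenvalue natrM natrB ?(ltnW rn) // le_eqVlt; apply/orP; left.
by apply/eqP; field; rewrite pred_neq0.
Qed.

(** The reflection of r into n-1-r exchanges the two geometric sums. *)
Lemma sum_eigenvalue_pow_le q : q = expR (- (4 * m%:R / n.-1%:R)) -> q < 1 ->
  \sum_(1 <= r < n.-1) a r ^+ (2 * m) <= 2 * (q / (1 - q)).
Proof.
move=> qE q1; have q0 : 0 <= q by rewrite qE expR_ge0.
apply: (@le_trans _ _ (\sum_(1 <= r < n.-1) (q ^+ r + q ^+ (n.-1 - r)))).
  by apply: ler_sum_nat => r rn; rewrite qE eigenvalue_pow_le.
rewrite big_split /=.
have -> : \sum_(1 <= r < n.-1) q ^+ (n.-1 - r) = \sum_(1 <= r < n.-1) q ^+ r.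
  rewrite big_nat_rev; apply: eq_big_nat => r /andP[r0 rn] /=.
  by congr (_ ^+ _); lia.
rewrite -mulr2n -[leLHS]mulr_natl ler_wpM2l ?ler0n //.
have qp : 0 < 1 - q by rewrite subr_gt0.
rewrite ler_pdivlMr // big_add1 big_mkord.
under eq_bigr => i _ do rewrite exprS.
rewrite -big_distrr /= -mulrA -[leRHS]mulr1 ler_wpM2l // mulrC -opprB mulNr -subrX1 opprB.
by rewrite lerBlDr lerDl exprn_ge0.
Qed.

Lemma tv_upper q : q = expR (- (4 * m%:R / n.-1%:R)) -> q < 1 ->
  tv (mu R n m.+1) (U R n m.+1) <= Num.sqrt (q / (1 - q) / 4).
Proof.
move=> qE q1; apply: tv_le; first exact: sqrtr_ge0.
move=> A; rewrite -sqrtr_sqr; apply: ler_wsqrtr.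
under eq_bigr => s _ do rewrite mu_sub_U.
apply: le_trans (sum_deviation_set_sqr A) _.
have := sum_eigenvalue_pow_le qE q1; lra.
Qed.

End Deviation.

(** * Lower bound from the derangement event *)

Section LowerBound.
Variable R : realType.

Lemma sum_inv_fact_le n : \sum_(i < n) (i`!%:R)^-1 <= expR 1 :> R.
Proof.
have -> : \sum_(i < n) (i`!%:R)^-1 = series (exp_coeff (1 : R)) n.
  rewrite /series /= big_mkord; apply: eq_bigr => i _.
  by rewrite /exp_coeff /= expr1n mul1r.
apply: nondecreasing_cvgn_le; last exact: is_cvg_series_exp_coeff.
by apply: nondecreasing_series => i _ _; apply: exp_coeff_ge0.
Qed.

(* [exp_trunc n.+2] is the proportion of derangements in [S_(n.+1)]. *)
Lemma exp_trunc_itv n : 0 <= exp_trunc R n <= 1.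
Proof.
case: n => [|[|n]]; rewrite /exp_trunc ?big_ord0 ?lexx ?ler01 //.
  by rewrite big_ord1 expr0 fact0 divr1 ler01 lexx.
rewrite -/(exp_trunc R n.+2).
have f0 : 0 < (n.+1`!%:R : R) by rewrite ltr0n fact_gt0.
suff -> : exp_trunc R n.+2 = #|derangements n.+1|%:R / (n.+1)`!%:R.
  rewrite divr_ge0 ?ler0n //= ler_pdivrMr // mul1r ler_nat.
  by rewrite -card_Sn max_card.
have := @sum_hook_coef_derangements R n 0 (leq0n n).
rewrite (eq_bigr (fun=> 1)) => [|s _]; last exact: hook_poly0.
rewrite sumr_const => ->; rewrite subn0 addn0 bin0 fact0 divr1 mulr1.
by rewrite /exp_trunc [in LHS]big_ord_recr.
Qed.

End LowerBound.

Section LowerBoundTV.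
Variable R : realType.
Local Notation a := (hook_eigenvalue R).

Lemma hook_eigenvalue_pow_norm n m r : (r < n)%N -> `|a n r ^+ m| <= 1.
Proof.
move=> rn; rewrite normrX exprn_ile1 //.
have [->|r0] := eqVneq r 0%N.
  by rewrite /hook_eigenvalue muln0 mul0r subr0 normr1.
have N0 : 0 < (n.-1%:R : R) by rewrite ltr0n ltn_predRL (leq_ltn_trans _ rn) ?lt0n.
have rN : (r%:R : R) <= n.-1%:R by rewrite ler_nat; move: rn; case: (n).
rewrite ler_norml /hook_eigenvalue natrM; apply/andP; split.
  by rewrite lerBrDl -lerBrDr opprK ler_pdivrMr //; lra.
by rewrite gerBl divr_ge0 ?mulr_ge0 ?ler0n.
Qed.

(** A negative power needs a negative eigenvalue, hence 2r >= n, and then the left side is at most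
    -1. The linear growth in r will be absorbed by r!. *)
Lemma hook_eigenvalue_pow_ge n m r : (r < n)%N ->
  - (2 * r%:R / n%:R) <= a n r ^+ m.
Proof.
move=> rn; have n0 : 0 < (n%:R : R) by rewrite ltr0n (leq_ltn_trans _ rn).
have [a0|a0] := leP 0 (a n r).
  apply: le_trans (exprn_ge0 _ a0); rewrite oppr_le0.
  by rewrite divr_ge0 ?mulr_ge0 ?ler0n.
have := hook_eigenvalue_pow_norm m rn; rewrite ler_norml => /andP[am1 _].
apply: le_trans am1; rewrite lerN2 ler_pdivlMr // mul1r.
have N0 : 0 < (n.-1%:R : R).
  rewrite ltr0n lt0n; apply/eqP => e; move: a0.
  by rewrite /hook_eigenvalue e invr0 mulr0 subr0 ltr10.
move: a0; rewrite /hook_eigenvalue subr_lt0 ltr_pdivlMr // mul1r ltr_nat.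
by rewrite -natrM ler_nat; move: rn; case: (n).
Qed.

Lemma bin_div_fact_le n r :
  'C(n, r)%:R / (n.+1)`!%:R <= (n.+1%:R * r`!%:R)^-1 :> R.
Proof.
have f0 k : 0 < (k`!%:R : R) by rewrite ltr0n fact_gt0.
rewrite factS natrM ler_pdivrMr ?mulr_gt0 ?ltr0n ?fact_gt0 //.
have -> : (n.+1%:R * r`!%:R)^-1 * (n.+1%:R * n`!%:R) = n`!%:R / r`!%:R :> R.
  by rewrite invfM mulrACA mulVf ?pnatr_eq0 // mul1r mulrC.
rewrite ler_pdivlMr // -natrM ler_nat.
case: (leqP r n) => rn; last by rewrite bin_small.
by rewrite -(bin_fact rn) mulnA leq_pmulr ?fact_gt0.
Qed.

Lemma tv_lower n m : (1 < n)%N ->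
  a n.+1 1 ^+ m * exp_trunc R n - 3 / n.+1%:R * expR 1
    <= tv (mu R n.+1 m.+1) (U R n.+1 m.+1).
Proof.
move=> n1; have n1' : (1 < n.+1)%N := ltnW n1.
apply: le_trans (tv_ge _ _ (derangements n.+1)).
under eq_bigr => s _ do rewrite mu_sub_U //.
rewrite -big_distrl exchange_big big_distrl /=.
have f0 k : 0 < (k`!%:R : R) by rewrite ltr0n fact_gt0.
have n0 : 0 < (n.+1%:R : R) by rewrite ltr0n.
(* Of the constant 3, the part 2 pays for a possibly negative eigenvalue power and 1 for the
   correction term of [sum_hook_coef_derangements]. The inverse factorials sum to at most
   [expR 1]. *)
pose err r : R := 3 / n.+1%:R / (r.-1)`!%:R.
have H r : (0 < r < n)%N ->
    (if r == 1%N then a n.+1 1 ^+ m * exp_trunc R n else 0) - err r <=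
    (\sum_(s in derangements n.+1) a n.+1 r ^+ m * (hook_poly R s)`_r) / (n.+1)`!%:R.
  move=> /andP[r0 rn].
  rewrite -big_distrr /= -mulrA sum_hook_coef_derangements ?(ltnW rn) //.
  have rn1 : (r < n.+1)%N by apply: leq_trans rn _.
  have am := hook_eigenvalue_pow_norm m rn1.
  have am1 := hook_eigenvalue_pow_ge m rn1.
  rewrite mulrDr.
  have rf : (r`!%:R : R) = r%:R * (r.-1)`!%:R by rewrite -{1}(prednK r0) factS natrM prednK.
  have r1 : 1 <= (r%:R : R) by rewrite ler1n.
  have E2 : - ((n.+1%:R)^-1 / (r.-1)`!%:R) <=
      a n.+1 r ^+ m * ((-1) ^+ (n.+1 + r) * 'C(n, r)%:R / (n.+1)`!%:R).
    suff : `|a n.+1 r ^+ m * ((-1) ^+ (n.+1 + r) * 'C(n, r)%:R / (n.+1)`!%:R)|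
         <= (n.+1%:R)^-1 / (r.-1)`!%:R by rewrite ler_norml => /andP[].
    rewrite normrM -mulrA normrMsign (ger0_norm (_ : 0 <= _ / _)) ?divr_ge0 ?ler0n //.
    apply: (@le_trans _ _ (1 * ('C(n, r)%:R / (n.+1)`!%:R))).
      by rewrite ler_wpM2r // divr_ge0 ?ler0n.
    rewrite mul1r; apply: le_trans (bin_div_fact_le _ _) _.
    rewrite rf -invfM lef_pV2 ?posrE ?mulr_gt0 //; last by lra.
    by rewrite ler_pM2l // ler_peMl // ltW.
  have /andP[T0 T1] := exp_trunc_itv R (n.+1 - r).
  case: eqP => [re|rne].
    move: E2; rewrite /err re subSS subn0 fact0 divr1 => E2.
    rewrite invr1 !mulr1 in E2 *; rewrite lerD2l; apply: le_trans E2.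
    by rewrite lerN2 ler_peMl ?invr_ge0 ?ltW //; lra.
  rewrite sub0r.
  have E1 : - (2 / n.+1%:R / (r.-1)`!%:R) <=
      a n.+1 r ^+ m * (exp_trunc R (n.+1 - r) / r`!%:R).
    have -> : 2 / n.+1%:R / (r.-1)`!%:R = 2 * r%:R / n.+1%:R * (1 / r`!%:R) :> R.
      rewrite rf; field; rewrite !gt_eqF //=; lra.
    rewrite -mulNr !mulrA ler_pM2r ?invr_gt0 // mulr1.
    have b0 : 0 <= 2 * r%:R / n.+1%:R :> R by rewrite divr_ge0 ?mulr_ge0 ?ler0n.
    apply: le_trans (ler_wpM2r T0 am1).
    by rewrite mulNr lerN2 ler_piMr.
  apply: le_trans (lerD E1 E2); rewrite -opprD lerN2 /err -mulrDl.
  rewrite ler_wpM2r ?invr_ge0 ?ler0n //.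
  by rewrite -[X in _ + X]mul1r -mulrDl ler_pM2r ?invr_gt0 //; lra.
apply: (@le_trans _ _ (\sum_(1 <= r < n)
    ((if r == 1%N then a n.+1 1 ^+ m * exp_trunc R n else 0) - err r))); last first.
  by apply: ler_sum_nat => r rn; apply: H.
rewrite sumrB; apply: lerB.
  rewrite big_ltn //= big_nat_cond big1 ?addr0 // => r /andP[/andP[r1 _] _].
  by rewrite gtn_eqF.
rewrite /err -big_distrr /= ler_wpM2l ?divr_ge0 ?ler0n //.
by rewrite big_add1 big_mkord sum_inv_fact_le.
Qed.

Lemma hook_eigenvalue1_pow_ge n m : (3 < n)%N ->
  expR (- (2 * (m%:R / (n%:R - 3)))) <= a n 1 ^+ m.
Proof.
move=> n3; have N3 : 3 < (n%:R : R) by rewrite ltr_nat.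
have E : n.-1%:R = n%:R - 1 :> R by rewrite -{2}(prednK (ltnW (ltnW (ltnW n3)))) -natr1 addrK.
have -> : - (2 * (m%:R / (n%:R - 3))) = m%:R * - (2 / (n%:R - 3)) :> R by ring.
rewrite expRM_natl; apply: lerXn2r; rewrite ?nnegrE ?expR_ge0 //.
  rewrite /hook_eigenvalue E subr_ge0 muln1 ler_pdivrMr; lra.
(* Writing (n-3)/(n-1) as an inverse turns the upper bound 1 + x <= exp(x) into a lower bound. *)
have -> : a n 1 = (1 + 2 / (n%:R - 3))^-1.
  by rewrite /hook_eigenvalue E muln1; field; rewrite !gt_eqF //; lra.
rewrite expRN lef_pV2 ?posrE ?expR_gt0 ?expR_ge1Dx //.
by rewrite addr_gt0 // divr_gt0 //; lra.
Qed.
End LowerBoundTV.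

(** * Limits *)

Local Open Scope classical_set_scope.
Local Open Scope ring_scope.

Section Limits.
Variables (R : realType) (c : R).
Hypothesis c0 : 0 < c.

Lemma cvg_inv_natr : (n%:R^-1 : R) @[n --> \oo] --> (0 : R).
Proof.
apply/gtr0_cvgV0; last exact: cvgr_idn.
by exists 1%N => // n /= n0; rewrite ltr0n.
Qed.

Lemma cvg_truncn_div : ((Num.truncn (c * n%:R))%:R / n%:R : R) @[n --> \oo] --> c.
Proof.
apply: (@squeeze_cvgr _ _ _ _ (fun n : nat => c - n%:R^-1) (fun=> c)); last first.
- exact: cvg_cst.
- rewrite -[X in _ --> X]subr0; apply: cvgB; [exact: cvg_cst | exact: cvg_inv_natr].
exists 1%N => // n /= n0; have np : 0 < (n%:R : R) by rewrite ltr0n.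
have /truncn_itv/andP[t1 t2] : 0 <= c * n%:R by rewrite mulr_ge0 ?ler0n ?ltW.
rewrite ler_pdivrMr // t1 andbT ler_pdivlMr // mulrBl mulVf ?gt_eqF //.
by rewrite lerBlDr natr1 ltW.
Qed.

Lemma cvg_truncn_div_sub (k : R) :
  ((Num.truncn (c * n%:R))%:R / (n%:R - k) : R) @[n --> \oo] --> c.
Proof.
have H : ((Num.truncn (c * n%:R))%:R / n%:R * (1 - k * n%:R^-1)^-1 : R) @[n --> \oo] --> c.
  rewrite -[X in _ --> X]mulr1; apply: cvgM; first exact: cvg_truncn_div.
  rewrite -[X in _ --> X]invr1; apply: cvgV; first exact: oner_neq0.
  rewrite -[X in _ --> X]subr0; apply: cvgB; first exact: cvg_cst.
  by rewrite -[X in _ --> X](mulr0 k); apply: cvgM; [exact: cvg_cst|exact: cvg_inv_natr].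
apply: cvg_trans H; apply: near_eq_cvg; exists 1%N => // n /= n0.
have np : (n%:R : R) != 0 by rewrite pnatr_eq0 -lt0n.
by rewrite -mulrA -invfM mulrBr mulr1 mulrCA mulfV // mulr1.
Qed.

Lemma cvg_expR_comp (u : nat -> R) (l : R) :
  u n @[n --> \oo] --> l -> expR (u n) @[n --> \oo] --> expR l.
Proof. by move=> ul; apply: continuous_cvg ul; exact: continuous_expR. Qed.

Lemma cvg_exp_trunc : exp_trunc R n @[n --> \oo] --> (expR (-1) : R).
Proof.
have -> : exp_trunc R = series (exp_coeff (-1 : R)).
  by apply/funext => n; rewrite /series /= big_mkord.
exact: is_cvg_series_exp_coeff.
Qed.

(** The positive part of the excess over [l] serves as the o(1) term: with it the inequality holds
    for every n, while an eventual bound suffices for convergence. *)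
Lemma cvg_exceedance (u v : nat -> R) (l : R) :
  (\forall n \near \oo, u n <= v n) -> v n @[n --> \oo] --> l ->
  Num.max 0 (u n - l) @[n --> \oo] --> (0 : R).
Proof.
move=> uv vl.
apply: (@squeeze_cvgr _ _ _ _ (fun=> 0) (fun n => `|v n - l|)).
- near=> n; rewrite le_max lexx /= ge_max normr_ge0 /=.
  apply: le_trans (ler_norm _); rewrite lerD2r.
  by near: n.
- exact: cvg_cst.
rewrite -[X in _ --> X](normr0 R) -(subrr l).
by apply: cvg_norm; apply: cvgB => //; exact: cvg_cst.
Unshelve. all: by end_near. Qed.

End Limits.

Theorem theorem3p1 (R : realType) (c : R) (hc : 0 < c) :
  exists e1 e2 : nat -> R,
    [/\ e1 n @[n --> \oo] --> (0 : R),
        e2 n @[n --> \oo] --> (0 : R)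
      & forall n : nat, (2 <= n)%N ->
          let k := (Num.truncn (c * n%:R)).+1 in
          expR (- (2 * c)) / expR 1 - e1 n <= tv (mu R n k) (U R n k)
          /\ tv (mu R n k) (U R n k)
             <= expR (- (2 * c)) / (2 * Num.sqrt (1 - expR (- (4 * c)))) + e2 n].
Proof.
pose m n := Num.truncn (c * n%:R).
pose d n := tv (mu R n (m n).+1) (U R n (m n).+1).
set L := expR (- (2 * c)) / expR 1; set H := _ / (2 * _).
(* The lower bound is negated so that both error terms have the form of [cvg_exceedance]. *)
exists (fun n => Num.max 0 (- d n - - L)), (fun n => Num.max 0 (d n - H)); split.
- pose lo n : R := expR (- (2 * ((m n)%:R / (n%:R - 3)))) * exp_trunc R n.-1
    - 3 / n%:R * expR 1.
  apply: (@cvg_exceedance _ _ (fun n => - lo n)).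
    exists 4%N => // n /= n4; rewrite lerN2 /lo.
    apply: le_trans (_ : hook_eigenvalue R n 1 ^+ m n * exp_trunc R n.-1
                           - 3 / n%:R * expR 1 <= _).
      have /andP[T0 _] := exp_trunc_itv R n.-1.
      by rewrite lerD2r ler_wpM2r // hook_eigenvalue1_pow_ge.
    by rewrite /d; move: (m n) => k; case: n n4 => // n n4; apply: tv_lower; apply: ltnW.
  apply: cvgN; rewrite -[L]subr0 /L -expRN; apply: cvgB.
    apply: cvgM.
      apply: cvg_expR_comp.
      by apply: cvgN; apply: cvgM; [exact: cvg_cst | exact: cvg_truncn_div_sub].
    by rewrite -cvg_shiftS; exact: cvg_exp_trunc.
  rewrite -[X in _ --> X](mul0r (expR 1)); apply: cvgM; last exact: cvg_cst.
  by rewrite -[X in _ --> X](mulr0 3); apply: cvgM; [exact: cvg_cst | exact: cvg_inv_natr].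
- pose q n : R := expR (- (4 * ((m n)%:R / (n%:R - 1)))).
  apply: (@cvg_exceedance _ _ (fun n => Num.sqrt (q n / (1 - q n) / 4))).
    (* Distance less than c from c makes the ratio positive, so that q n < 1. *)
    have /cvgrPdist_lt/(_ c hc) := cvg_truncn_div_sub hc 1.
    apply: filterS2 (nbhs_infty_ge 2) => n /= n2 cm.
    have E : n.-1%:R = n%:R - 1 :> R by rewrite -{2}(prednK (ltnW n2)) -natr1 addrK.
    apply: tv_upper => //; first by rewrite /q E mulrA.
    rewrite /q expR_lt1 oppr_lt0 mulr_gt0 //.
    by move: cm; rewrite -/(m n) => /ltr_normlW; rewrite ltrBlDr -ltrBlDl subrr.
  have qc : q n @[n --> \oo] --> expR (- (4 * c)).
    apply: cvg_expR_comp.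
    by apply: cvgN; apply: cvgM; [exact: cvg_cst | exact: cvg_truncn_div_sub].
  have q1 : 0 < 1 - expR (- (4 * c)) by rewrite subr_gt0 expR_lt1 oppr_lt0 mulr_gt0.
  have -> : H = Num.sqrt (expR (- (4 * c)) / (1 - expR (- (4 * c))) / 4).
    rewrite /H; set s := 1 - _.
    (* The limit is put under a single square root, so that its continuity gives the convergence. *)
    have -> : expR (- (4 * c)) / s / 4 = (expR (- (2 * c)) / (2 * Num.sqrt s)) ^+ 2.
      rewrite expr_div_n exprMn sqr_sqrtr ?(ltW q1) // -expRM_natl.
      rewrite (_ : 2%:R * _ = - (4 * c)); last by ring.
      by field; rewrite gt_eqF.
    rewrite sqrtr_sqr ger0_norm // divr_ge0 ?expR_ge0 // mulr_ge0 ?sqrtr_ge0 //.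
  apply: continuous_cvg; first exact: sqrt_continuous.
  apply: cvgM; last exact: cvg_cst.
  apply: cvgM => //; apply: cvgV; first by rewrite gt_eqF.
  by apply: cvgB => //; exact: cvg_cst.
move=> n n2 k; rewrite -/(d n); split.
  by rewrite lerBlDr -lerBlDl le_max opprK [- _ + _]addrC lexx orbT.
by rewrite -lerBlDl le_max lexx orbT.
Qed.
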